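(* Let $m=m(n)$ be a function of $n$. (i) Suppose that $\frac{4n}{m}=\log n+\omega$, where $\omega=\omega(n)\rightarrow\infty$ as $n\rightarrow\infty$. Then asymptotically almost surely $G(n,m,2)$ is connected. (ii) Suppose that $\frac{4n}{m}=\log n-\omega$, where $\omega=\omega(n)\rightarrow\infty$ as $n\rightarrow\infty$. Then asymptotically almost surely $G(n,m,2)$ is not connected.
   Context: The uniform random intersection graph $G(n,m,k)$ (for positive integers $k\le m$) is the random graph on a set $V$ of $n$ nodes defined as follows: fix a set $M$ of $m$ colours; to each node $v\in V$ assign a subset $F_v\subseteq M$ of exactly $k$ distinct colours, chosen uniformly at random among all $k$-subsets of $M$, independently for different nodes; distinct nodes $u,v$ are joined by an edge if and only if $F_u\cap F_v\neq\emptyset$. Here $k=2$. An event holds asymptotically almost surely if its probability tends to $1$ as $n\rightarrow\infty$. Here $\log$ denotes the natural logarithm. *)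

(* Defs.v *)
From HB Require Import structures.
From mathcomp Require Import all_boot all_order all_algebra.
From mathcomp Require Import all_classical all_reals all_analysis.
Set Implicit Arguments. Unset Strict Implicit. Unset Printing Implicit Defensive.
Import Order.TTheory GRing.Theory Num.Theory.
Local Open Scope ring_scope.

(* A colour assignment for G(n,m,k): node v : 'I_n gets a set F v of colours
   from the colour set 'I_m, of size exactly k. *)
Definition rig_assignments (n m k : nat) : {set {ffun 'I_n -> {set 'I_m}}} :=
  [set F : {ffun 'I_n -> {set 'I_m}} | [forall v, #|F v| == k]].

Definition rig_edge (n m : nat) (F : {ffun 'I_n -> {set 'I_m}}) : rel 'I_n :=
  fun u v => (u != v) && ~~ [disjoint F u & F v].

Definition rig_connected (n m : nat) (F : {ffun 'I_n -> {set 'I_m}}) : bool :=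
  [forall u, forall v, connect (rig_edge F) u v].

(* Since the k-subsets are chosen uniformly and independently, the law of
   (F_v)_v is the uniform distribution on rig_assignments n m k.  The
   probability that G(n,m,k) satisfies the event P: *)
Definition rig_prob (R : realType) (n m k : nat)
    (P : {ffun 'I_n -> {set 'I_m}} -> bool) : R :=
  #|[set F in rig_assignments n m k | P F]|%:R / #|rig_assignments n m k|%:R.

(* Main.v *)
Require Import Defs.
From HB Require Import structures.
From mathcomp Require Import all_boot all_order all_algebra.
From mathcomp Require Import all_classical all_reals all_analysis.
From mathcomp Require Import lra ring zify.
Import Order.TTheory GRing.Theory Num.Theory.
Import numFieldNormedType.Exports.
Local Open Scope ring_scope.

(** Think of the nodes as [n] random edges on the colour set ['I_m].

    (i) If the graph is disconnected, the colours of some component form a set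
    [S] with [2 <= s = #|S| <= m / 2] such that every [F v] lies in [S] or in
    its complement and at least [s / 2] of them lie in [S].  Weighting each node
    inside [S] by [mu ^+ 2], with [mu >= 1], a union bound gives
      [\sum_s 'C(m, s) * mu ^- s * (mu ^+ 2 * x ^+ 2 + (1 - x) ^+ 2) ^+ n]
    where [x = s / m].  With [L = 4 n / m], the choice [mu ^+ 2 = 1 / (x L)]
    (or [mu = 1] when [x L > 1]) bounds the [s]-th term by
    [(8 * expR 1 * expR (- w / 8)) ^+ s], so the sum is dominated by a geometric
    series which tends to 0.

    (ii) Let [X] count the isolated nodes and let [q] be the probability that two
    random pairs of colours are disjoint.  Then [E X = n * q ^+ n.-1], and since
    the probability that a pair misses four given colours is at most [q ^+ 2],
    [E (X (X - 1)) <= (E X) ^+ 2 / q].  Chebyshev's inequality gives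
    [P (X = 0) <= 1 / E X + 1 / q - 1], which is of order [expR (- w / 2)]. *)

Set Implicit Arguments. Unset Strict Implicit. Unset Printing Implicit Defensive.

(** * Counting colour assignments *)

Lemma card_rig_assignments n m k : #|rig_assignments n m k| = ('C(m, k) ^ n)%N.
Proof.
have := @card_ffun_on 'I_n _ [pred A : {set 'I_m} | #|A| == k].
have -> : #|[pred A : {set 'I_m} | #|A| == k]| = 'C(m, k).
  by rewrite -[in RHS](card_ord m) -card_draws cardsE.
rewrite card_ord => <-; apply: eq_card => F; rewrite inE.
by apply/forallP/ffun_onP => h v; have := h v; rewrite ?inE.
Qed.

(** Independence of the nodes in counting form: distributing the product over the sums produces
    every choice of one [k]-set per node. *)
Lemma sum_rig_assignments (R : comPzRingType) n m k
    (g : 'I_n -> {set 'I_m} -> R) :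
  \sum_(F in rig_assignments n m k) \prod_v g v (F v) =
  \prod_v \sum_(A : {set 'I_m} | #|A| == k) g v A.
Proof.
rewrite bigA_distr_big; apply: eq_bigl => F.
by rewrite inE; apply/forallP/ffun_onP.
Qed.

Lemma sum_draws (R : pzRingType) (T : finType) k (B : {set T}) (P : pred {set T}) :
  (forall A : {set T}, P A = (A \subset B)) ->
  \sum_(A : {set T} | #|A| == k) (P A)%:R = 'C(#|B|, k)%:R :> R.
Proof.
move=> hP; rewrite -cards_draws -sum1_card natr_sum big_mkcond /=.
rewrite [RHS]big_mkcond /=; apply: eq_bigr => A _.
by rewrite inE hP; case: (A \subset B); case: (_ == k).
Qed.

(** * Colour sets of components *)

(** With nodes read as edges on the colours, this is the vertex set of the component that contains
    the edge [F w]. *)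
Definition colour_component n m (F : {ffun 'I_n -> {set 'I_m}}) w : {set 'I_m} :=
  \bigcup_(x | connect (rig_edge F) w x) F x.

Lemma connect_rig_edge_sym n m (F : {ffun 'I_n -> {set 'I_m}}) :
  connect_sym (rig_edge F).
Proof.
by apply: sym_connect_sym => x y; rewrite /rig_edge eq_sym disjoint_sym.
Qed.

Lemma connect_common_colour n m (F : {ffun 'I_n -> {set 'I_m}}) x y c :
  c \in F x -> c \in F y -> connect (rig_edge F) x y.
Proof.
move=> cx cy; have [-> //|nxy] := eqVneq x y.
apply: connect1; rewrite /rig_edge nxy /=; apply/pred0Pn.
by exists c; rewrite /= cx cy.
Qed.

Lemma colour_component_sub n m (F : {ffun 'I_n -> {set 'I_m}}) w x :
  connect (rig_edge F) w x -> F x \subset colour_component F w.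
Proof. by move=> wx; exact: (finset.bigcup_sup x). Qed.

Lemma colour_component_disjoint n m (F : {ffun 'I_n -> {set 'I_m}}) u v :
  ~~ connect (rig_edge F) u v ->
  [disjoint colour_component F u & colour_component F v].
Proof.
move=> nuv; apply/pred0Pn => -[c /= /andP[/finset.bigcupP[x ux cx] /finset.bigcupP[y vy cy]]].
move/negP: nuv; apply; apply: connect_trans ux _.
apply: connect_trans (connect_common_colour cx cy) _.
by rewrite connect_rig_edge_sym.
Qed.

Lemma colour_component_subC n m (F : {ffun 'I_n -> {set 'I_m}}) w x :
  ~~ connect (rig_edge F) w x -> F x \subset ~: colour_component F w.
Proof.
move=> nwx; rewrite -finset.disjoints_subset disjoint_sym.
apply: disjointWr (colour_component_disjoint nwx).
exact: colour_component_sub (connect0 _ _).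
Qed.

(** The last clause holds for components because [s] colours cannot be covered by fewer than [s / 2]
    pairs; it is what pays for the factor [mu ^- s] in the union bound. *)
Definition separating n m (F : {ffun 'I_n -> {set 'I_m}}) (S : {set 'I_m}) :=
  [&& [forall x, (F x \subset S) || (F x \subset ~: S)],
      (1 < #|S|)%N, (#|S|.*2 <= m)%N
    & (#|S| <= #|[set x | F x \subset S]|.*2)%N].

Lemma card_colour_component n m (F : {ffun 'I_n -> {set 'I_m}}) w :
  F \in rig_assignments n m 2 ->
  (1 < #|colour_component F w|)%N /\
  (#|colour_component F w| <= #|[set x | F x \subset colour_component F w]|.*2)%N.
Proof.
rewrite inE => /forallP F2; split.
  rewrite -(eqP (F2 w)); apply: subset_leq_card.
  exact: colour_component_sub (connect0 _ _).
apply: leq_trans (_ : #|[set x | connect (rig_edge F) w x]|.*2 <= _)%N; last first.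
  rewrite leq_double; apply: subset_leq_card; apply/fintype.subsetP => x.
  by rewrite !inE; exact: colour_component_sub.
rewrite -muln2 -sum_nat_const /colour_component.
rewrite (eq_bigl (connect (rig_edge F) w)); last by move=> x; rewrite inE.
elim/big_rec2: _ => [|x s A _ le]; first by rewrite cards0.
by rewrite (leq_trans (leq_card_setU _ _))// leq_add// (eqP (F2 x)).
Qed.

(** Two unconnected nodes have disjoint colour components, so the smaller one has at most [m / 2]
    colours. *)
Lemma disconnected_separating n m (F : {ffun 'I_n -> {set 'I_m}}) :
  F \in rig_assignments n m 2 -> ~~ rig_connected F ->
  exists S, separating F S.
Proof.
move=> FA /forallPn[u /forallPn[v nuv]].
suff [w hw] : exists w, (#|colour_component F w|.*2 <= m)%N.
  exists (colour_component F w); have [c1 c2] := card_colour_component w FA.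
  rewrite /separating hw c1 c2 !andbT; apply/forallP => x.
  case: (boolP (connect (rig_edge F) w x)) => wx.
    by rewrite colour_component_sub.
  by rewrite (colour_component_subC wx) orbT.
have := max_card (mem (colour_component F u :|: colour_component F v)).
rewrite card_ord cardsU; have := colour_component_disjoint nuv.
rewrite -finset.setI_eq0 => /eqP ->; rewrite cards0 subn0 => le.
case: (leqP #|colour_component F u| #|colour_component F v|) => [l|/ltnW l].
  by exists u; apply: leq_trans le; rewrite -addnn leq_add2l.
by exists v; apply: leq_trans le; rewrite -addnn leq_add2r.
Qed.

(** * Finite sums and elementary rules for the probability *)

Lemma card_setC_ord m (S : {set 'I_m}) : #|~: S| = (m - #|S|)%N.
Proof. by rewrite cardsCs finset.setCK card_ord. Qed.

Lemma prod_natr_forall (R : comPzRingType) (I : finType) (b : pred I) :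
  \prod_i (b i)%:R = [forall i, b i]%:R :> R.
Proof.
case: forallP => [h|h]; first by rewrite big1// => i _; rewrite h.
have /existsP[i nbi] : [exists i, ~~ b i].
  by rewrite -negb_forall; apply/negP => /forallP.
by rewrite (bigD1 i)//= (negbTE nbi) mul0r.
Qed.

Lemma sum_set_card (R : pzSemiRingType) (T : finType) (P : pred nat) (G : nat -> R) :
  \sum_(S : {set T} | P #|S|) G #|S| =
  \sum_(0 <= s < #|T|.+1 | P s) 'C(#|T|, s)%:R * G s.
Proof.
rewrite big_mkord.
rewrite (partition_big (fun S : {set T} => inord #|S| : 'I_#|T|.+1)
  (fun s : 'I_#|T|.+1 => P s)) /=; last first.
  by move=> S; rewrite inordK// ltnS max_card.
apply: eq_bigr => s Ps.
rewrite (eq_bigl (fun S : {set T} => S \in [set S : {set T} | #|S| == s])%SET).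
  rewrite (eq_bigr (fun=> G s)); last by move=> S; rewrite inE => /eqP ->.
  by rewrite sumr_const card_draws mulr_natl.
move=> S; rewrite inE; have lS : (#|S| < #|T|.+1)%N by rewrite ltnS max_card.
apply/andP/eqP => [[_ /eqP <-]|e]; first by rewrite inordK.
by rewrite e Ps; split=> //; apply/eqP/val_inj; rewrite /= inordK.
Qed.

Lemma rig_assignments_gt0 n m k : (k <= m)%N -> (0 < #|rig_assignments n m k|)%N.
Proof. by move=> km; rewrite card_rig_assignments expn_gt0 bin_gt0 km. Qed.

Lemma rig_probC (R : realType) n m k (P : {ffun 'I_n -> {set 'I_m}} -> bool) :
  (k <= m)%N -> rig_prob R k P = 1 - rig_prob R k (fun F => ~~ P F).
Proof.
move=> km; rewrite /rig_prob.
have N0 : #|rig_assignments n m k|%:R != 0 :> R.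
  by rewrite pnatr_eq0 -lt0n rig_assignments_gt0.
apply/eqP; rewrite eq_sym subr_eq -mulrDl -natrD eq_sym; apply/eqP.
rewrite -[RHS](divff N0); congr (_%:R / _).
rewrite -[RHS](cardsID [set F | P F]%SET); congr (_ + _)%N;
  by apply: eq_card => F; rewrite !inE// andbC.
Qed.

Lemma rig_prob_ge0 (R : realType) n m k (P : {ffun 'I_n -> {set 'I_m}} -> bool) :
  0 <= rig_prob R k P.
Proof. by rewrite divr_ge0. Qed.

Lemma rig_prob_le1 (R : realType) n m k (P : {ffun 'I_n -> {set 'I_m}} -> bool) :
  (k <= m)%N -> rig_prob R k P <= 1.
Proof. by move=> km; rewrite rig_probC// lerBlDr lerDl rig_prob_ge0. Qed.

Lemma rig_probE (R : realType) n m k (P : {ffun 'I_n -> {set 'I_m}} -> bool) :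
  rig_prob R k P =
  (\sum_(F in rig_assignments n m k) (P F)%:R) / ('C(m, k)%:R ^+ n).
Proof.
rewrite /rig_prob card_rig_assignments natrX; congr (_ / _).
rewrite -sum1_card natr_sum [LHS]big_mkcond [RHS]big_mkcond /=.
by apply: eq_bigr => F _; rewrite !inE; case: (P F); rewrite ?andbT ?andbF; case: ifP.
Qed.

(** * Weighted union bound for disconnection *)

(** A node inside [S] contributes at least [mu ^+ 2] and any other node contributes 1. At least
    [#|S| / 2] nodes are inside, so the product is at least [mu ^+ #|S|]. *)
Lemma separating_weight (R : realType) n m (F : {ffun 'I_n -> {set 'I_m}}) S (mu : R) :
  1 <= mu -> separating F S ->
  1 <= mu ^- #|S| *
       \prod_v (mu ^+ 2 * (F v \subset S)%:R + (F v \subset ~: S)%:R).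
Proof.
move=> mu1 /and4P[/forallP sep _ _ half].
have mu0 : 0 < mu by rewrite (lt_le_trans _ mu1).
rewrite mulrC ler_pdivlMr ?exprn_gt0// mul1r.
apply: le_trans (_ : \prod_v (if F v \subset S then mu ^+ 2 else 1) <= _).
  rewrite -big_mkcond /= prodr_const -exprM mul2n.
  rewrite (eq_card (_ : _ =i [set x | F x \subset S]%SET)); last first.
    by move=> x; rewrite inE.
  exact: ler_weXn2l.
apply: ler_prod => v _; have := sep v.
case: (boolP (F v \subset S)) => [_ _|_ /= ->].
  by rewrite mulr1 lerDl ler0n andbT exprn_ge0// ltW.
by rewrite ler01 mulr0 add0r lexx.
Qed.

(** The indicator of disconnection is at most the sum of the weights over all candidate [S]; after
    exchanging the sums, each weight factors over the nodes. The weight [mu] may depend on the size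
    [s], so it can be tuned to each term. *)
Lemma rig_prob_disconnected_le (R : realType) n m (mu : nat -> R) :
  (forall s, 1 <= mu s) ->
  rig_prob R 2 (fun F : {ffun 'I_n -> {set 'I_m}} => ~~ rig_connected F) <=
  \sum_(0 <= s < m.+1 | (1 < s)%N && (s.*2 <= m)%N)
    'C(m, s)%:R * (mu s ^- s *
     ((mu s ^+ 2 * 'C(s, 2)%:R + 'C(m - s, 2)%:R) / 'C(m, 2)%:R) ^+ n).
Proof.
move=> mu1; rewrite rig_probE; set N := 'C(m, 2)%:R ^+ n.
pose h (S A : {set 'I_m}) : R :=
  mu #|S| ^+ 2 * (A \subset S)%:R + (A \subset ~: S)%:R.
have mu0 s : 0 <= mu s by rewrite (le_trans _ (mu1 s)).
have hge0 S A : 0 <= h S A by rewrite addr_ge0// mulr_ge0// exprn_ge0.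
apply: le_trans (_ : (\sum_(F in rig_assignments n m 2)
    \sum_(S : {set 'I_m} | (1 < #|S|)%N && (#|S|.*2 <= m)%N)
      mu #|S| ^- #|S| * \prod_v h S (F v)) / N <= _).
  rewrite ler_wpM2r ?invr_ge0 ?exprn_ge0//; apply: ler_sum => F FA.
  have t0 (S : {set 'I_m}) : 0 <= mu #|S| ^- #|S| * \prod_v h S (F v).
    by rewrite mulr_ge0 ?invr_ge0 ?exprn_ge0 ?prodr_ge0.
  case: (boolP (rig_connected F)) => [_|nc] /=; first by rewrite sumr_ge0.
  have [S sepS] := disconnected_separating FA nc.
  rewrite (bigD1 S)/=; last by case/and4P: sepS => _ -> ->.
  by apply: ler_wpDr (separating_weight (mu1 _) sepS); rewrite sumr_ge0.
rewrite exchange_big /= mulr_suml.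
rewrite (eq_bigr (fun S : {set 'I_m} => mu #|S| ^- #|S| *
  ((mu #|S| ^+ 2 * 'C(#|S|, 2)%:R + 'C(m - #|S|, 2)%:R) / 'C(m, 2)%:R) ^+ n)).
  rewrite (sum_set_card _ (fun s => (1 < s)%N && (s.*2 <= m)%N) (fun s => mu s ^- s *
     ((mu s ^+ 2 * 'C(s, 2)%:R + 'C(m - s, 2)%:R) / 'C(m, 2)%:R) ^+ n)).
  by rewrite card_ord.
move=> S _; rewrite -mulr_sumr (sum_rig_assignments 2 (fun _ : 'I_n => h S)) prodr_const card_ord.
rewrite -mulrA expr_div_n; congr (_ * (_ ^+ _ / _)).
rewrite big_split /= -mulr_sumr (sum_draws _ _ (B := S))//.
by rewrite (sum_draws _ _ (B := ~: S)%SET)// card_setC_ord.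
Qed.

(** * Isolated nodes and the second moment method *)

Definition isolated_node n m (F : {ffun 'I_n -> {set 'I_m}}) v :=
  [forall u, (u != v) ==> (F u \subset ~: F v)].

Lemma isolated_disconnected n m (F : {ffun 'I_n -> {set 'I_m}}) v :
  (1 < n)%N -> isolated_node F v -> ~~ rig_connected F.
Proof.
move=> n1 /forallP iso.
have [u uv] : exists u : 'I_n, u != v.
  have : (0 < #|predC1 v|)%N by rewrite cardC1 card_ord; case: n n1 {F v iso} => [|[]].
  by case/card_gt0P => u; rewrite inE => ?; exists u.
apply/negP => /forallP /(_ v) /forallP /(_ u) /connectP[[|x p] /=].
  by move=> _ e; rewrite e eqxx in uv.
case/andP => /andP[vx dis] _ _; have := iso x.
rewrite eq_sym vx /= -finset.disjoints_subset disjoint_sym.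
exact/negP.
Qed.

Lemma sum_draws_eq (R : pzRingType) (T : finType) k (A : {set T}) :
  #|A| == k -> \sum_(B : {set T} | #|B| == k) (B == A)%:R = 1 :> R.
Proof.
move=> Ak; rewrite (bigD1 A)//= eqxx big1 ?addr0// => B /andP[_ /negbTE ->].
by [].
Qed.

(** Once [F v] is fixed, the other [n.-1] nodes avoid its two colours independently. *)
Lemma sum_isolated (R : comPzRingType) n m (v : 'I_n) :
  \sum_(F in rig_assignments n m 2) (isolated_node F v)%:R =
  'C(m, 2)%:R * 'C(m - 2, 2)%:R ^+ n.-1 :> R.
Proof.
rewrite (partition_big (fun F : {ffun 'I_n -> {set 'I_m}} => F v)
  (fun A => #|A| == 2)) /=; last by move=> F; rewrite inE => /forallP.
rewrite (eq_bigr (fun=> 'C(m - 2, 2)%:R ^+ n.-1)).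
  rewrite sumr_const -[LHS]mulr_natl; congr (_%:R * _).
  by rewrite -[in RHS](card_ord m) -card_draws cardsE.
move=> A A2.
pose g u B : R := (if u == v then B == A else B \subset ~: A)%:R.
transitivity (\sum_(F in rig_assignments n m 2) \prod_u g u (F u)).
  rewrite big_mkcondr /=; apply: eq_bigr => F _; rewrite prod_natr_forall.
  case: eqP => [e|ne].
    congr (_%:R); congr (nat_of_bool _); apply: eq_forallb => u.
    by case: eqP => [->|_] /=; rewrite e ?eqxx.
  case: forallP => // /(_ v); by rewrite eqxx => /eqP.
rewrite sum_rig_assignments (bigD1 v)//= /g eqxx sum_draws_eq// mul1r.
rewrite (eq_bigr (fun=> 'C(m - 2, 2)%:R)) ?prodr_const ?cardC1 ?card_ord//.
move=> u /negbTE ->; rewrite (sum_draws _ _ (B := ~: A)%SET)//.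
by rewrite card_setC_ord (eqP A2).
Qed.

Lemma sum_isolated2 (R : comPzRingType) n m (u v : 'I_n) : u != v ->
  \sum_(F in rig_assignments n m 2) (isolated_node F u && isolated_node F v)%:R =
  'C(m, 2)%:R * 'C(m - 2, 2)%:R * 'C(m - 4, 2)%:R ^+ n.-2 :> R.
Proof.
move=> uv.
rewrite (partition_big (fun F : {ffun 'I_n -> {set 'I_m}} => F u)
  (fun A => #|A| == 2)) /=; last by move=> F; rewrite inE => /forallP.
rewrite (eq_bigr (fun=> 'C(m - 2, 2)%:R * 'C(m - 4, 2)%:R ^+ n.-2)).
  rewrite sumr_const -[LHS]mulr_natl mulrA; congr (_%:R * _ * _).
  by rewrite -[in RHS](card_ord m) -card_draws cardsE.
move=> A A2.
rewrite (partition_big (fun F : {ffun 'I_n -> {set 'I_m}} => F v)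
  (fun A => #|A| == 2)) /=; last by move=> F; rewrite inE => /andP[/forallP].
rewrite (eq_bigr (fun B : {set 'I_m} =>
  (B \subset ~: A)%:R * 'C(m - 4, 2)%:R ^+ n.-2)).
  rewrite -mulr_suml (sum_draws _ _ (B := ~: A)%SET)//.
  by rewrite card_setC_ord (eqP A2).
move=> B B2.
(* With [F u] and [F v] pinned to [A] and [B], the joint event becomes a product of conditions on
   single nodes, apart from the disjointness of [A] and [B]. *)
pose g w C : R := (if w == u then C == A else
   if w == v then C == B else C \subset ~: (A :|: B))%:R.
transitivity (\sum_(F in rig_assignments n m 2)
   (B \subset ~: A)%:R * \prod_w g w (F w)).
  rewrite [LHS]big_mkcond [RHS]big_mkcond /=; apply: eq_bigr => F _.
  case: (F \in _) => //=; rewrite prod_natr_forall.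
  case: eqP => [eA|ne] /=; last first.
    case: forallP; last by rewrite mulr0.
    by move=> /(_ u); rewrite eqxx => /eqP.
  case: eqP => [eB|ne] /=; last first.
    case: forallP; last by rewrite mulr0.
    by move=> /(_ v); rewrite eqxx eq_sym (negbTE uv) => /eqP.
  rewrite -natrM mulnb; congr (nat_of_bool _)%:R.
  apply/andP/andP => [[/forallP iu /forallP iv]|[BA /forallP h]].
    split; first by have := iu v; rewrite eq_sym uv eA eB.
    apply/forallP => w; case: eqP => [->|/eqP wu]; first by rewrite eA.
    case: eqP => [->|/eqP wv]; first by rewrite eB.
    rewrite finset.setCU finset.subsetI.
    by have := iu w; have := iv w; rewrite wu wv eA eB /= => -> ->.
  have AB : A \subset ~: B by rewrite finset.subsetC.
  split; apply/forallP => w; apply/implyP => nw; have := h w.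
    rewrite (negbTE nw) eA; case: eqP => [-> /eqP ->//|_].
    by rewrite finset.setCU finset.subsetI => /andP[].
  rewrite (negbTE nw) eB; case: eqP => [-> /eqP ->//|_].
  by rewrite finset.setCU finset.subsetI => /andP[].
rewrite -mulr_sumr sum_rig_assignments.
case: (boolP (B \subset ~: A)) => [BA|]; last by rewrite !mul0r.
rewrite !mul1r (bigD1 u)//= (bigD1 v)//=; last by rewrite eq_sym.
rewrite /g eqxx sum_draws_eq// mul1r eq_sym (negbTE uv) eqxx sum_draws_eq// mul1r.
rewrite (eq_bigr (fun=> 'C(m - 4, 2)%:R)).
  rewrite prodr_const; congr (_ ^+ _).
  have := cardC (pred2 u v); rewrite card2 uv card_ord => e.
  by rewrite -[in RHS]e; apply: eq_card => w; rewrite !inE negb_or.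
move=> w /andP[/negbTE -> /negbTE ->].
rewrite (sum_draws _ _ (B := ~: (A :|: B))%SET)//.
rewrite card_setC_ord cardsU.
have -> : A :&: B = finset.set0.
  by apply/eqP; rewrite finset.setI_eq0 disjoint_sym finset.disjoints_subset.
by rewrite cards0 (eqP A2) (eqP B2).
Qed.

(** Where [X] vanishes, [(X t - E) ^+ 2] equals [E ^+ 2]; summed over [O], these squares give the
    variance because [E] is the mean. *)
Lemma chebyshev_zero (R : realType) (T : finType) (O : {set T}) (X : T -> R) (E : R) :
  \sum_(t in O) X t = #|O|%:R * E ->
  (\sum_(t in O) (X t == 0)%:R) * E ^+ 2 <=
  \sum_(t in O) X t ^+ 2 - #|O|%:R * E ^+ 2.
Proof.
move=> EX; apply: le_trans (_ : \sum_(t in O) (X t - E) ^+ 2 <= _).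
  rewrite mulr_suml; apply: ler_sum => t _; case: eqP => [->|_].
    by rewrite mul1r sub0r sqrrN.
  by rewrite mul0r sqr_ge0.
rewrite (eq_bigr (fun t => X t ^+ 2 - 2 * E * X t + E ^+ 2)); last by move=> t _; ring.
rewrite big_split sumrB /= -mulr_sumr EX sumr_const -mulr_natl.
by rewrite le_eqVlt; apply/orP; left; apply/eqP; ring.
Qed.

Lemma bin2R (R : realFieldType) n : 'C(n, 2)%:R = n%:R * (n%:R - 1) / 2 :> R.
Proof.
have : ('C(n, 2) * 2 = n * n.-1)%N by rewrite -(ffactn1 n.-1) -ffactnS -bin_ffact.
move/(congr1 (fun k => k%:R : R)); rewrite [LHS]natrM [RHS]natrM => h.
rewrite -[LHS](mulfK (_ : 2 != 0 :> R)) ?pnatr_eq0// h.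
(* The truncated [n.-1] differs from [n%:R - 1] only at [n = 0], where the factor [n%:R]
   vanishes. *)
by case: n {h} => [|n]; rewrite ?mul0r//= -natr1 addrK.
Qed.

Lemma sum_sqr_isolated (R : realType) n m :
  \sum_(F in rig_assignments n m 2) (\sum_v (isolated_node F v)%:R) ^+ 2 =
  n%:R * ('C(m, 2)%:R * 'C(m - 2, 2)%:R ^+ n.-1) +
  n%:R * n.-1%:R * ('C(m, 2)%:R * 'C(m - 2, 2)%:R * 'C(m - 4, 2)%:R ^+ n.-2) :> R.
Proof.
under eq_bigr => F _.
  rewrite expr2 mulr_suml.
  under eq_bigr => u _ do rewrite mulr_sumr.
  over.
rewrite exchange_big /=.
under eq_bigr => u _.
  rewrite exchange_big (bigD1 u)//=.
  under eq_bigr => F _ do rewrite -natrM mulnb andbb.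
  rewrite sum_isolated.
  under eq_bigr => v vu.
    under eq_bigr => F _ do rewrite -natrM mulnb.
    rewrite sum_isolated2 1?eq_sym//; over.
  rewrite sumr_const cardC1 card_ord; over.
rewrite sumr_const card_ord -[LHS]mulr_natl mulrDr -[in RHS]mulrA.
by congr (_ + _ * _); rewrite [RHS]mulr_natl.
Qed.

Lemma rig_prob_connected_le (R : realType) n m : (1 < n)%N -> (5 < m)%N ->
  forall q : R, q = 'C(m - 2, 2)%:R / 'C(m, 2)%:R ->
  rig_prob R 2 (@rig_connected n m) <= (n%:R * q ^+ n.-1)^-1 + (q^-1 - 1).
Proof.
move=> n1 m5 q qE; pose c : R := 'C(m, 2)%:R; pose E := n%:R * q ^+ n.-1.
have c0 : 0 < c by rewrite ltr0n bin_gt0; lia.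
have q0 : 0 < q by rewrite qE divr_gt0// ltr0n bin_gt0; lia.
have E0 : 0 < E by rewrite mulr_gt0 ?exprn_gt0// ltr0n; lia.
pose X (F : {ffun 'I_n -> {set 'I_m}}) : R := \sum_v (isolated_node F v)%:R.
have EX : \sum_(F in rig_assignments n m 2) X F = #|rig_assignments n m 2|%:R * E.
  rewrite exchange_big /=; under eq_bigr => v _ do rewrite sum_isolated.
  rewrite sumr_const card_ord -mulr_natl card_rig_assignments natrX -/c.
  rewrite /E qE expr_div_n -/c -[in c ^+ n](prednK (ltnW n1)) exprS.
  by field; rewrite expf_neq0// gt_eqF.
have := chebyshev_zero EX; rewrite card_rig_assignments natrX -/c => cheb.
rewrite rig_probE -/c -/E ler_pdivrMr ?exprn_gt0//.
rewrite -(ler_pM2r (exprn_gt0 2 E0)).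
apply: le_trans (le_trans cheb _).
  rewrite ler_pM2r ?exprn_gt0//; apply: ler_sum => F _; rewrite ler_nat.
  case: (boolP (rig_connected F)) => // conn; rewrite /X big1 ?eqxx// => v _.
  by case: (boolP (isolated_node F v)) => // /(isolated_disconnected n1); rewrite conn.
rewrite sum_sqr_isolated.
case: n n1 @E E0 {X EX cheb} => [//|[//|k]] _ E E0 /=; rewrite -/c.
pose r : R := 'C(m - 4, 2)%:R / c.
have r0 : 0 <= r by rewrite divr_ge0.
have Cq : 'C(m - 2, 2)%:R = q * c by rewrite qE divfK// gt_eqF.
have Cr : 'C(m - 4, 2)%:R = r * c by rewrite /r divfK// gt_eqF.
(* This is ['C(m - 4, 2) * 'C(m, 2) <= 'C(m - 2, 2) ^ 2], a polynomial inequality in [m] once the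
   binomials are expanded. *)
have rq : r <= q ^+ 2.
  rewrite -(ler_pM2r (exprn_gt0 2 c0)) -exprMn -Cq expr2 mulrA -Cr /c !bin2R.
  rewrite !natrB//; [|lia|lia]; have : 6 <= m%:R :> R by rewrite (ler_nat _ 6).
  by move: (m%:R : R) => x hx; nra.
rewrite Cq Cr.
have rqk : r ^+ k <= q ^+ (2 * k) by rewrite exprM lerXn2r// nnegrE ltW// exprn_gt0.
apply: le_trans (_ : c ^+ k.+2 * (E + k.+2%:R ^+ 2 * (q * q ^+ (2 * k))
   - E ^+ 2) <= _).
  rewrite [leRHS]mulrBr lerB// mulrDr lerD//.
    rewrite /E /= exprMn !exprS le_eqVlt; apply/orP; left; apply/eqP; ring.
  rewrite exprMn (_ : _ * _ = c ^+ k.+2 * (k.+2%:R * k.+1%:R * (q * r ^+ k))).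
    rewrite ler_pM2l ?exprn_gt0// expr2 ler_pM//; last by rewrite ler_pM2l.
    - by rewrite mulr_ge0 ?exprn_ge0// ltW.
    - by rewrite ler_wpM2l// ler_nat.
  rewrite !exprS; ring.
rewrite le_eqVlt; apply/orP; left; apply/eqP.
(* Here [q] has exponent [2 * k + 1], one less than in [E ^+ 2]; this is the source of [q^-1] in the
   bound. *)
have -> : k.+2%:R ^+ 2 * (q * q ^+ (2 * k)) = E ^+ 2 / q.
  by rewrite /E /= mul2n -addnn exprD (exprS q k); field; rewrite gt_eqF.
rewrite -/E; move: (c ^+ k.+2) E E0 => C E E0.
by field; rewrite !gt_eqF.
Qed.

(** Here [q^-1 - 1] is about [4 / m], so [q ^- n.-1] is at most about
    [expR (4 * n / m) = n * expR (- w)]. This makes the first term of order [expR (- w)]; the second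
    is of order [n ^ (- 1 / 2)], and [w <= ln n]. *)
Lemma isolation_rate (R : realType) (n m : nat) (w : R) : (1 < n)%N -> (1 < m)%N ->
  4 * n%:R / m%:R = ln (n%:R : R) - w -> 16 <= w ->
  forall q : R, q = 'C(m - 2, 2)%:R / 'C(m, 2)%:R ->
  (5 < m)%N /\
  (n%:R * q ^+ n.-1)^-1 + (q^-1 - 1) <= (expR 7 + 4) * expR (- (w / 2)).
Proof.
move=> n1 m1 Lw w16 q qE; set N : R := n%:R; set M : R := m%:R.
have N0 : 0 < N by rewrite ltr0n; lia.
have M0 : 0 < M by rewrite ltr0n; lia.
set L := 4 * N / M in Lw.
have L0 : 0 < L by rewrite divr_gt0// mulr_gt0.
(* [y] is the square root of [N]. Since [L > 0] forces [ln N > 16], it is at least 9, and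
   [L <= ln N <= 2 * y] turns [M * L = 4 * y ^+ 2] into [M >= 2 * y]. *)
pose y := expR (ln N / 2).
have yN : y ^+ 2 = N by rewrite -expRM_natr divfK// lnK.
have yl : 1 + ln N / 2 <= y by exact: expR_ge1Dx.
have y9 : 9 <= y by lra.
have L2 : L <= 2 * y by lra.
have ML : M * L = 4 * N by rewrite /L mulrC divfK// gt_eqF.
have M2 : 2 * y <= M.
  have : M * L <= M * (2 * y) by rewrite ler_pM2l.
  rewrite ML -yN => h; rewrite -(ler_pM2r (_ : 0 < 2 * y)); last by lra.
  by apply: le_trans h; rewrite le_eqVlt; apply/orP; left; apply/eqP; ring.
have m5 : (5 < m)%N by rewrite -(ltr_nat R) -/M; lra.
split => //.
pose d := q^-1 - 1.
have dE : d = (4 * M - 6) / ((M - 2) * (M - 3)).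
  rewrite /d qE !bin2R natrB ?(ltnW m1)// -/M.
  by field; rewrite !gt_eqF//=; lra.
have q0 : 0 < q by rewrite qE divr_gt0// ltr0n bin_gt0; lia.
have D0 : 0 < (M - 2) * (M - 3) by apply: mulr_gt0; lra.
have dM : d <= 8 / M.
  rewrite dE ler_pdivrMr//.
  by rewrite mulrAC ler_pdivlMr//; nra.
have dy : d <= 4 / y.
  apply: le_trans dM _; rewrite ler_pdivrMr// mulrAC ler_pdivlMr; lra.
have LM : L <= M by lra.
(* The main term of [N * d] is [4 * N / M = L]; the constant 7 absorbs the lower order terms. *)
have Nd : N * d <= L + 7.
  have -> : N = M * L / 4 by rewrite ML; field.
  rewrite dE mulrA ler_pdivrMr//.
  have : L * (7 * M - 12) <= 14 * ((M - 2) * (M - 3)) by nra.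
  nra.
have eN : expR (- ln N) = N^-1 by rewrite expRN lnK.
have b1 : (N * q ^+ n.-1)^-1 <= expR (7 - w).
  have d0 : 0 <= d by rewrite dE divr_ge0//; nra.
  rewrite invfM -exprVn (_ : q^-1 = 1 + d); last by rewrite /d; ring.
  apply: le_trans (_ : N^-1 * expR (N * d) <= _).
    rewrite ler_pM2l ?invr_gt0// expRM_natl.
    apply: le_trans (_ : (1 + d) ^+ n <= _).
      by rewrite ler_weXn2l ?lerDl// leq_pred.
    apply: lerXn2r (expR_ge1Dx d); rewrite nnegrE ?expR_ge0//.
    by rewrite addr_ge0.
  by rewrite -eN -expRD ler_expR; lra.
have eyw : y^-1 <= expR (- (w / 2)) by rewrite /y -expRN ler_expR; lra.
rewrite mulrDl lerD//.
  by apply: le_trans b1 _; rewrite -expRD ler_expR; lra.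
by apply: le_trans dy _; rewrite ler_pM2l.
Qed.

(** * Estimates for the terms of the union bound *)

Lemma ffact_le_expn n k : (n ^_ k <= n ^ k)%N.
Proof.
elim: k n => [|k IH] n //; rewrite ffactnS expnS leq_mul2l.
apply/orP; right; apply: leq_trans (IH _) _; case: k {IH} => [//|k].
by rewrite leq_exp2r// leq_pred.
Qed.

(** A crude Stirling bound, by induction from [(1 + 1 / t) ^+ t <= expR 1]; the step from 0 to 1 is
    separate because it would need [t = 0]. *)
Lemma expn_le_expR_fact (R : realType) s :
  (s%:R : R) ^+ s <= expR 1 ^+ s * s`!%:R.
Proof.
elim: s => [|s IH]; first by rewrite !expr0 mul1r.
case: s IH => [_|s IH].
  by rewrite !expr1 mulr1; have := expR_ge1Dx (1 : R); lra.
set t := s.+1 in IH *.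
have t0 : 0 < t%:R :> R by rewrite ltr0n.
have h : (t.+1%:R : R) ^+ t <= expR 1 * t%:R ^+ t.
  have -> : t.+1%:R = (1 + t%:R^-1) * t%:R :> R.
    by rewrite mulrDl mulVf ?gt_eqF// mul1r -natr1.
  rewrite exprMn ler_pM2r ?exprn_gt0//.
  have -> : expR 1 = expR (t%:R^-1) ^+ t :> R.
    by rewrite -expRM_natr mulVf// gt_eqF.
  by rewrite lerXn2r ?nnegrE ?expR_ge0 ?addr_ge0 ?invr_ge0 ?(ltW t0)// expR_ge1Dx.
rewrite [leLHS]exprS factS natrM.
apply: le_trans (_ : t.+1%:R * (expR 1 * (expR 1 ^+ t * t`!%:R)) <= _).
  rewrite ler_pM2l ?ltr0n//; apply: le_trans h _.
  by rewrite ler_pM2l ?expR_gt0.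
by rewrite exprS le_eqVlt; apply/orP; left; apply/eqP; ring.
Qed.

Lemma bin_le_expR (R : realType) m s : (0 < s)%N ->
  'C(m, s)%:R <= (expR 1 * (m%:R / s%:R)) ^+ s :> R.
Proof.
move=> s0; have S0 : 0 < s%:R :> R by rewrite ltr0n.
have f0 : 0 < s`!%:R :> R by rewrite ltr0n fact_gt0.
rewrite mulrA expr_div_n ler_pdivlMr ?exprn_gt0//.
apply: le_trans (_ : 'C(m, s)%:R * (expR 1 ^+ s * s`!%:R) <= _).
  by rewrite ler_wpM2l// expn_le_expR_fact.
rewrite mulrCA -natrM bin_ffact exprMn ler_pM2l ?exprn_gt0 ?expR_gt0//.
by rewrite -natrX ler_nat ffact_le_expn.
Qed.

(* Weight giving each node inside [S] a factor [mu ^+ 2]: it balances the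
   contributions [mu ^+ 2 * x ^+ 2 * n] and [s * ln mu] for [x = s / m]. *)
Definition tilt (R : realType) (n m s : nat) : R :=
  let xL := s%:R / m%:R * (4 * n%:R / m%:R) in
  if xL <= 1 then (Num.sqrt xL)^-1 else 1.

(** Positivity of [n], [m] and [s] keeps [xL] away from 0, where the inverse would default to 0. *)
Lemma tilt_ge1 (R : realType) n m s : (0 < n)%N -> (0 < m)%N -> (0 < s)%N ->
  1 <= tilt R n m s.
Proof.
move=> n0 m0 s0; rewrite /tilt; case: ifP => // le1.
rewrite invf_ge1 -?[leRHS]sqrtr1 ?ler_sqrt ?ler01// sqrtr_gt0.
by rewrite !mulr_gt0 ?invr_gt0 ?ltr0n.
Qed.

(** With [x = s / m], a pair lies inside with probability at most [x ^+ 2] and outside with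
    probability at most [(1 - x) ^+ 2]. Then [1 + u <= expR u], and [n * x = s * (n / m)] makes the
    whole bound an [s]-th power. *)
Lemma separating_term_le (R : realType) (n m s : nat) (mu : R) :
  (1 < s)%N -> (s.*2 <= m)%N -> 1 <= mu ->
  'C(m, s)%:R * (mu ^- s *
     ((mu ^+ 2 * 'C(s, 2)%:R + 'C(m - s, 2)%:R) / 'C(m, 2)%:R) ^+ n) <=
  (expR 1 * (m%:R / s%:R) * mu^-1 *
   expR (n%:R / m%:R * ((1 + mu ^+ 2) * (s%:R / m%:R) - 2))) ^+ s.
Proof.
move=> s1 sm mu1.
have mu0 : 0 < mu by rewrite (lt_le_trans _ mu1).
have S2 : 2 <= s%:R :> R by rewrite ler_nat.
have SM : 2 * s%:R <= m%:R :> R by rewrite -natrM ler_nat mul2n.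
have c0 : 0 < 'C(m, 2)%:R :> R by rewrite ltr0n bin_gt0; lia.
rewrite [leRHS]exprMn [X in _ <= X * _]exprMn -[leRHS]mulrA exprVn.
rewrite ler_pM//; first by rewrite mulr_ge0 ?invr_ge0 ?exprn_ge0 ?divr_ge0
  ?addr_ge0 ?mulr_ge0 ?exprn_ge0// ltW.
  by rewrite bin_le_expR// ltnW.
rewrite ler_pM2l ?invr_gt0 ?exprn_gt0// -expRM_natr.
set M : R := m%:R in SM *; set S : R := s%:R in S2 SM *.
have M0 : 0 < M by lra.
have -> : n%:R / M * ((1 + mu ^+ 2) * (S / M) - 2) * S =
    ((1 + mu ^+ 2) * (S / M) ^+ 2 - 2 * (S / M)) * n%:R.
  by field; rewrite gt_eqF.
rewrite expRM_natr lerXn2r ?nnegrE ?expR_ge0//.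
  by rewrite divr_ge0 ?addr_ge0 ?mulr_ge0 ?exprn_ge0// ltW.
apply: le_trans (expR_ge1Dx _).
rewrite ler_pdivrMr// !bin2R natrB; last by lia.
rewrite -/M -/S; have mu2 : 1 <= mu ^+ 2 by rewrite exprn_ege1.
move: (mu ^+ 2) mu2 => t t1.
have -> : S / M = M^-1 * S by rewrite mulrC.
set i := M^-1.
have iM : M * i = 1 by rewrite mulfV// gt_eqF.
have i0 : 0 < i by rewrite invr_gt0.
have e1 : S * (S - 1) <= (i * S) ^+ 2 * (M * (M - 1)).
  have -> : (i * S) ^+ 2 * (M * (M - 1)) = (M * i) * (S * S) * (M * i - i) by ring.
  rewrite iM mul1r; have : i * S <= 1 by rewrite mulrC ler_pdivrMr//; lra.
  nra.
have e2 : (M - S) * (M - S - 1) <= (1 - i * S) ^+ 2 * (M * (M - 1)).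
  have -> : (1 - i * S) ^+ 2 * (M * (M - 1)) =
     (M - (M * i) * S) * (M - 1 - (M * i) * S + i * S) by ring.
  rewrite iM mul1r; have : 0 <= i * S by rewrite mulr_ge0; lra.
  nra.
nra.
Qed.

Lemma separating_base_le (R : realType) (n m s : nat) (w : R) :
  (0 < n)%N -> (1 < s)%N -> (s.*2 <= m)%N -> 0 <= w ->
  4 * n%:R / m%:R = ln (n%:R : R) + w ->
  forall mu : R, mu = tilt R n m s ->
  expR 1 * (m%:R / s%:R) * mu^-1 *
   expR (n%:R / m%:R * ((1 + mu ^+ 2) * (s%:R / m%:R) - 2)) <=
  8 * expR 1 * expR (- (w / 8)).
Proof.
move=> n0 s1 sm w0 Lw mu ->.
set M : R := m%:R in Lw *; set S : R := s%:R; set N : R := n%:R in Lw *.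
have S2 : 2 <= S by rewrite (ler_nat _ 2).
have SM : 2 * S <= M by rewrite /S /M -natrM ler_nat mul2n.
have N1 : 1 <= N by rewrite (ler_nat _ 1).
have M0 : 0 < M by lra.
have S0 : 0 < S by lra.
have N0 : 0 < N by lra.
have lN : 0 <= ln N by rewrite ln_ge0.
pose L := 4 * N / M; rewrite -/L in Lw.
have NM : N / M = L / 4 by rewrite /L; field; rewrite gt_eqF.
rewrite NM; pose x := S / M; rewrite -/x.
have -> : M / S = x^-1 by rewrite /x invfM invrK mulrC.
have L0 : 0 < L by rewrite divr_gt0// mulr_gt0.
have x0 : 0 < x by rewrite divr_gt0.
have x2 : x <= 1 / 2 by rewrite ler_pdivrMr//; lra.
rewrite -[8 * _ * _]mulrA [leRHS]mulrCA -!(mulrA (expR 1)) ler_pM2l ?expR_gt0//.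
rewrite /tilt -/N -/M -/S -/L -/x; case: ifPn => [le1|]; last first.
  rewrite -ltNge => xL; rewrite invr1 mulr1 expr1n.
  (* Case [mu = 1]: since [x <= 1 / 2] the exponent is at most [- L / 4]; half of it absorbs
     [x^-1 <= L <= 8 * expR (L / 8)], and [L >= w]. *)
  have xV : x^-1 <= L by rewrite -[x^-1]mul1r ler_pdivrMr// mulrC ltW.
  have h8 : L <= 8 * expR (L / 8) by have := expR_ge1Dx (L / 8); lra.
  apply: le_trans (_ : (8 * expR (L / 8)) * expR (- (L / 4)) <= _).
    rewrite ler_pM ?invr_ge0 ?expR_ge0 ?(ltW x0)//.
      exact: le_trans xV h8.
    by rewrite ler_expR; nra.
  by rewrite -mulrA -expRD ler_pM2l// ler_expR; lra.
set y := Num.sqrt (x * L); rewrite invrK.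
have xL0 : 0 < x * L by rewrite mulr_gt0.
have y0 : 0 < y by rewrite sqrtr_gt0.
have y2 : y ^+ 2 = x * L by rewrite sqr_sqrtr// ltW.
(* [z] is [N ^ (- 1 / 2)]: since [x * L <= 1], the exponent is at most [(1 - L) / 2], which splits
   off [z], [expR (- (w / 2))] and [expR (1 / 2)]. *)
pose z := expR (- (ln N / 2)).
have z0 : 0 < z by exact: expR_gt0.
have z2 : z ^+ 2 * N = 1.
  rewrite -expRM_natr mulNr divfK// expRN lnK// mulVf// gt_eqF//.
(* The square of the left side is exactly [4 / S]. *)
have h2 : x^-1 * y * z <= 2.
  rewrite -(@ler_pXn2r _ 2)// ?nnegrE ?mulr_ge0 ?invr_ge0 ?(ltW x0) ?(ltW y0) ?(ltW z0)//.
  rewrite !exprMn y2.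
  have -> : x^-1 ^+ 2 * (x * L) * z ^+ 2 = 4 / S * (z ^+ 2 * N).
    by rewrite /x /L; field; rewrite !gt_eqF.
  by rewrite z2 mulr1 ler_pdivrMr//; lra.
have eh : expR (1 / 2) <= 2 :> R.
  have := expR_ge1Dx (- (1 / 2) : R); rewrite expRN => h.
  have e0 := expR_gt0 (1 / 2 : R).
  rewrite -[leRHS]invrK -[leLHS]invrK lef_pV2 ?posrE ?invr_gt0//.
  by apply: le_trans h; lra.
apply: le_trans (_ : x^-1 * y * (z * expR (- (w / 2)) * expR (1 / 2)) <= _).
  rewrite ler_pM2l ?mulr_gt0 ?invr_gt0// /z -!expRD ler_expR.
  rewrite exprVn y2.
  have -> : L / 4 * ((1 + (x * L)^-1) * x - 2) = x * L / 4 + 1 / 4 - L / 2.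
    by field; rewrite !gt_eqF.
  lra.
rewrite !mulrA -mulrA.
apply: le_trans (_ : 2 * (expR (- (w / 2)) * 2) <= _).
  rewrite ler_pM ?mulr_ge0 ?invr_ge0 ?expR_ge0 ?(ltW x0) ?(ltW y0) ?(ltW z0)//.
  by rewrite ler_pM2l ?expR_gt0.
have : expR (- (w / 2)) <= expR (- (w / 8)) by rewrite ler_expR; lra.
have := expR_gt0 (- (w / 2)); lra.
Qed.

Lemma rig_prob_disconnected_small (R : realType) (n m : nat) (w : R) :
  (0 < n)%N -> 0 <= w -> 4 * n%:R / m%:R = ln (n%:R : R) + w ->
  forall e : R, e = 8 * expR 1 * expR (- (w / 8)) -> e <= 1 / 2 ->
  rig_prob R 2 (fun F : {ffun 'I_n -> {set 'I_m}} => ~~ rig_connected F) <= 4 * e.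
Proof.
move=> n0 w0 Lw e eE e2.
have e0 : 0 < e by rewrite eE !mulr_gt0// expR_gt0.
(* The value 1 outside the relevant range provides [1 <= mu s] for every [s], as the union bound
   requires. *)
pose mu s := if (0 < m)%N && (0 < s)%N then tilt R n m s else 1.
have mu1 s : 1 <= mu s by rewrite /mu; case: ifP => // /andP[]; exact: tilt_ge1.
apply: le_trans (rig_prob_disconnected_le n m mu1) _.
apply: le_trans (_ : \sum_(0 <= s < m.+1 | (1 < s)%N && (s.*2 <= m)%N)
  2 * e * (1 / 2) ^+ s <= _).
  apply: ler_sum => s /andP[s1 sm].
  apply: le_trans (separating_term_le n s1 sm (mu1 s)) _.
  rewrite /mu (_ : (0 < m)%N && (0 < s)%N); last by lia.
  (* One factor [e] is kept and the other [s - 1] are bounded by [1 / 2], so the total stays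
     proportional to [e]. *)
  apply: le_trans (_ : e ^+ s <= _).
    rewrite lerXn2r ?nnegrE ?(ltW e0)//; last by rewrite eE; exact: separating_base_le.
    by rewrite !mulr_ge0 ?expR_ge0 ?invr_ge0// (le_trans _ (tilt_ge1 _ _ _ _))//; lia.
  case: s s1 {sm} => // s _; rewrite !exprS.
  have -> : 2 * e * (1 / 2 * (1 / 2) ^+ s) = e * (1 / 2) ^+ s by field.
  by rewrite ler_pM2l// lerXn2r ?nnegrE ?(ltW e0)//; lra.
apply: le_trans (_ : \sum_(0 <= s < m.+1) 2 * e * (1 / 2) ^+ s <= _).
  rewrite [leLHS]big_mkcond; apply: ler_sum => s _; case: ifP => // _.
  by rewrite !mulr_ge0 ?exprn_ge0 ?(ltW e0)//; lra.
rewrite -mulr_sumr (_ : 4 * e = 2 * e * 2); last by ring.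
rewrite ler_pM2l ?mulr_gt0//.
have -> : \sum_(0 <= s < m.+1) (1 / 2) ^+ s = 2 - 2 * (1 / 2) ^+ m.+1 :> R.
  elim: m.+1 => [|k IH]; first by rewrite big_geq// expr0; ring.
  by rewrite big_nat_recr//= IH exprS; field.
by rewrite lerBlDr lerDl mulr_ge0// exprn_ge0//; lra.
Qed.

(** * Passage to the limit *)

Local Open Scope classical_set_scope.
Local Open Scope ring_scope.

Lemma cvg_expRN_div (R : realType) (w : nat -> R) (c : R) : 0 < c ->
  w @ \oo --> +oo -> (fun n => expR (- (w n / c))) @ \oo --> (0 : R).
Proof.
move=> c0 /cvgryPge cw.
apply: (cvg_comp (fun n => w n / c) (fun x => expR (- x)) _ (@cvgr_expR R)).
apply/cvgryPge => A; have := cw (A * c); apply: filterS => n.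
by rewrite ler_pdivlMr.
Qed.

(** A squeeze; the threshold [a] is eventually passed because [w] diverges. *)
Lemma cvg_to_1_expRN (R : realType) (w P : nat -> R) (a b c : R) : 0 < c ->
  w @ \oo --> +oo -> (forall n, P n <= 1) ->
  (forall n, a <= w n -> 1 - b * expR (- (w n / c)) <= P n) ->
  P @ \oo --> (1 : R).
Proof.
move=> c0 cw P1 Pw.
apply: (@squeeze_cvgr _ _ _ _ (fun n => 1 - b * expR (- (w n / c))) (fun=> 1)).
- by move/cvgryPge : cw => /(_ a); apply: filterS => n /Pw ->; rewrite P1.
- rewrite -[X in _ --> X]subr0 -[X in _ - X](mulr0 b).
  apply: cvgB; first exact: cvg_cst.
  by apply: cvgM; [exact: cvg_cst|exact: cvg_expRN_div].
- exact: cvg_cst.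
Qed.

Unset Implicit Arguments.

Theorem theorem3 (R : realType) (m : nat -> nat)
    (hm : forall n : nat, (2 <= m n)%N) :
  ((exists w : nat -> R, w @ \oo --> +oo /\
      forall n : nat, 4 * n%:R / (m n)%:R = ln (n%:R : R) + w n) ->
    (fun n => @rig_prob R n (m n) 2 (@rig_connected n (m n))) @ \oo --> (1 : R))
  /\
  ((exists w : nat -> R, w @ \oo --> +oo /\
      forall n : nat, 4 * n%:R / (m n)%:R = ln (n%:R : R) - w n) ->
    (fun n => @rig_prob R n (m n) 2 (fun F => ~~ rig_connected F)) @ \oo --> (1 : R)).
Proof.
split => -[w [cw Lw]].
- apply: (@cvg_to_1_expRN R w _ 1 (4 * (8 * expR 1)) 8) => // n.
    exact: rig_prob_le1.
  move=> w1.
  (* At [n = 0] the convention [ln 0 = 0] would give [w n = 0], against [1 <= w n]. *)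
  have n0 : (0 < n)%N.
    rewrite lt0n; apply/eqP => n0; move: w1 (Lw n).
    by rewrite n0 mulr0 mul0r ln0//; lra.
  rewrite -mulrA rig_probC// lerB//.
  (* If the base exceeds [1 / 2], the claimed bound exceeds 2 and is trivial for a probability. *)
  have [e2|e2] := leP (8 * expR 1 * expR (- (w n / 8))) (1 / 2).
    by apply: (rig_prob_disconnected_small n0 _ (Lw n)) => //; lra.
  by apply: le_trans (rig_prob_le1 _ _ (hm n)) _; lra.
- apply: (@cvg_to_1_expRN R w _ 16 (expR 7 + 4) 2) => // n.
    exact: rig_prob_le1.
  move=> w16.
  (* For [n <= 1] the logarithm is 0, so a nonnegative quotient would equal [- w n < 0]. *)
  have n1 : (1 < n)%N.
    rewrite ltnNge; apply/negP => n1; have := Lw n.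
    have -> : ln (n%:R : R) = 0.
      by case: n n1 {w16} => [|[|//]] _; [exact: ln0|exact: ln1].
    have : 0 <= 4 * n%:R / (m n)%:R :> R by rewrite divr_ge0 ?mulr_ge0.
    by lra.
  have [m5 le] := isolation_rate n1 (hm n) (Lw n) w16 erefl.
  rewrite rig_probC// lerB//.
  rewrite (_ : rig_prob _ _ _ = rig_prob R 2 (@rig_connected n (m n))).
    exact: le_trans (rig_prob_connected_le n1 m5 erefl) le.
  by rewrite /rig_prob; congr (_%:R / _); apply: eq_card => F; rewrite !inE negbK.
Qed.
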